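(* For every integer $n\ge 0$, $c_3(11n+5)\equiv c_3(11n+7)\equiv c_3(11n+9)\equiv 0\pmod 2$.
   Context: A partition of $n\ge 0$ is a finite multiset of positive integers summing to $n$. For $n\ge 0$, $c_3(n)$ denotes the number of partitions $\lambda$ of $n$ for which there exists an integer $j\ge 1$ such that: the part $1$ appears in $\lambda$ exactly $j^2$ or exactly $j^2+1$ times; every odd part greater than $1$ appears at most once; the even parts of $\lambda$ are distinct; and every even part of $\lambda$ is either at most $2j$, or is a multiple of $4$ that is at least $4j+4$ (in particular no even integer in $\{2j+2,2j+4,\dots,4j+2\}$ is a part). *)

(* Defs.v *)
From mathcomp Require Import all_boot.
Set Implicit Arguments. Unset Strict Implicit. Unset Printing Implicit Defensive.

(* A partition of n is encoded by its multiplicity function: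
   m : {ffun 'I_n.+1 -> 'I_n.+1}, where m k is the number of times the part k
   (1 <= k <= n) occurs; we require m 0 = 0 and \sum_k k * m k = n.
   This is a bijection with the finite multisets of positive integers
   summing to n (every part is <= n and occurs at most n times). *)
Definition is_partition (n : nat) (m : {ffun 'I_n.+1 -> 'I_n.+1}) : bool :=
  (m ord0 == 0 :> nat) && (\sum_(k < n.+1) k * m k == n).

Definition mult (n : nat) (m : {ffun 'I_n.+1 -> 'I_n.+1}) (k : nat) : nat :=
  if insub k is Some i then nat_of_ord (m i) else 0.

(* The c_3 condition for a given j >= 1 (boolean; parts k range over 1..n,
   larger k have multiplicity 0 and satisfy every constraint vacuously). *)
Definition c3_cond (n : nat) (m : {ffun 'I_n.+1 -> 'I_n.+1}) (j : nat) : bool :=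
  [&& 1 <= j,
      (mult m 1 == j ^ 2) || (mult m 1 == j ^ 2 + 1),
      [forall k : 'I_n.+1, (odd k && (1 < k)) ==> (m k <= 1)],
      [forall k : 'I_n.+1, (~~ odd k && (0 < k)) ==> (m k <= 1)] &
      [forall k : 'I_n.+1, [&& ~~ odd k, 0 < k & 0 < m k] ==>
          ((k <= 2 * j) || ((4 %| k) && (4 * j + 4 <= k)))]].

Definition c3 (n : nat) : nat :=
  #|[set m : {ffun 'I_n.+1 -> 'I_n.+1} |
       is_partition m && [exists j : 'I_n.+2, c3_cond m j]]|.

(* Sanity: j is automatically bounded, since j <= j^2 <= mult m 1 <= n. *)

(* Main.v *)
(** Let A = prod (1 + q^(2i+1)) and E = prod (1 + q^(2i)).  Modulo 2 the partitions
    counted by c_3 with parameter j have generating function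
    q^(j^2) A E_j (E / E_j)^2 = A E^2 q^(j^2) / E_j, where E_j is the product of the
    first j factors of E, and Euler's identity sum_j q^(j^2) / (q^2; q^2)_j = A
    turns the sum over j >= 1 into A E^2 (A - 1) = E - A E^2.  By the Jacobi triple
    product, E is the theta series of 3 j^2 + j and A E^2 that of 2 j^2 + j, over
    all integers j; neither form takes the values 5, 7, 9 modulo 11.  All
    identities are used for polynomials over F_2 modulo a power of 'X, in the
    finite form given by q-binomial coefficients. *)

Require Import Defs.
From mathcomp Require Import all_boot all_order all_algebra ring zify.

Set Implicit Arguments.
Unset Strict Implicit.
Unset Printing Implicit Defensive.

Import GRing.Theory.

Local Open Scope ring_scope.

(** * Gaussian binomials and the q-binomial theorem *)

Section QBinomial.

Context (R : comNzRingType) (Q : R).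

Definition qpoch (n : nat) : R := \prod_(i < n) (1 - Q ^+ i.+1).

(** Gaussian binomial by the q-Pascal rule, which avoids dividing by [qpoch] and so makes sense in
    any commutative ring. *)
Fixpoint qbin (n k : nat) : R :=
  match n, k with
  | _, 0 => 1
  | 0, _.+1 => 0
  | n'.+1, k'.+1 => qbin n' k' + Q ^+ k * qbin n' k
  end.

Lemma qbin0 n : qbin n 0 = 1. Proof. by case: n. Qed.

Lemma qbin_small n k : (n < k)%N -> qbin n k = 0.
Proof.
elim: n k => [|n IHn] [|k] //= lt_nk.
by rewrite !IHn ?mulr0 ?addr0 // ltnW.
Qed.

Lemma qpochS n : qpoch n.+1 = qpoch n * (1 - Q ^+ n.+1).
Proof. by rewrite /qpoch big_ord_recr. Qed.

Lemma qbin_qpoch m k : qbin (m + k) k * qpoch k * qpoch m = qpoch (m + k).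
Proof.
move Dn: (m + k)%N => n; elim: n m k Dn => [|n IHn] m k Dn.
  have [-> ->] : m = 0%N /\ k = 0%N by lia.
  by rewrite /qpoch !big_ord0 /= !mulr1.
case: k Dn => [|k] Dn; first by rewrite qbin0 -Dn addn0 /qpoch big_ord0 !mul1r.
have Dn' : (m + k = n)%N by lia.
rewrite /= !qpochS.
have IH1 := IHn m k Dn'.
case: m Dn Dn' IH1 => [|m] Dn Dn' IH1.
  rewrite (@qbin_small n k.+1) ?mulr0 ?addr0; last by lia.
  have Dk : n = k by lia.
  by rewrite Dk in IH1 *; rewrite -[in RHS]IH1; ring.
have IH2 := IHn m k.+1 ltac:(lia).
have -> : Q ^+ n.+1 = Q ^+ k.+1 * Q ^+ m.+1 by rewrite -exprD; congr (_ ^+ _); lia.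
rewrite qpochS in IH2; rewrite qpochS in IH1 *.
(* This splitting of the last factor mirrors the two terms of the q-Pascal rule. *)
have -> : qpoch n * (1 - Q ^+ k.+1 * Q ^+ m.+1) =
  qpoch n * (1 - Q ^+ k.+1) + Q ^+ k.+1 * qpoch n * (1 - Q ^+ m.+1) by ring.
by rewrite -{1}IH1 -IH2; ring.
Qed.

(** The induction peels off the factor [i = 0], which replaces [v] by [v * Q] in the others. The
    form homogeneous in [u] and [v] later allows monomials for both, in place of negative powers of
    ['X]. *)
Lemma qbinomial_theorem n (u v : R) :
  \prod_(i < n) (u + v * Q ^+ i) =
  \sum_(k < n.+1) qbin n k * Q ^+ 'C(k, 2) * v ^+ k * u ^+ (n - k).
Proof.
elim: n v => [|n IHn] v.
  by rewrite big_ord0 big_ord1 /= !expr0 !mulr1.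
rewrite big_ord_recl /= expr0 mulr1.
under eq_bigr => i _ do rewrite /bump /= add1n exprS mulrA.
rewrite IHn.
pose T k := qbin n k * Q ^+ 'C(k.+1, 2) * v ^+ k.
rewrite (eq_bigr (fun k : 'I_n.+1 => T k * u ^+ (n - k))); last first.
  by move=> k _; rewrite /T exprMn binS bin1 exprD; ring.
rewrite [RHS]big_ord_recl /= ?bin0n !expr0 subn0 !mulr1 mul1r.
under [in RHS]eq_bigr => i _ do
  rewrite /bump /= add1n subSS !mulrDl.
(* The [u] half of the peeled factor matches the second q-Pascal term together with [k = 0]; the [v]
   half matches the first. *)
rewrite big_split /= mulrDl [X in _ = _ + X]addrC addrA; congr (_ + _).
  rewrite big_ord_recl /= {1}/T qbin0 (@bin_small 1 2) // !expr0 !mul1r subn0 mulrDr -exprS; congr (_ + _).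
  rewrite [in RHS]big_ord_recr /= qbin_small // mulr0 !mul0r addr0.
  rewrite big_distrr /=; apply: eq_bigr => i _.
  have Di : (n - i = (n - i.+1).+1)%N by have := ltn_ord i; lia.
  by rewrite /bump /= add1n /T Di (binS i.+1) bin1 exprD !exprS; ring.
rewrite big_distrr /=; apply: eq_bigr => i _.
by rewrite /T exprS; ring.
Qed.

End QBinomial.

(** * Congruences of polynomials modulo a power of ['X] *)

Section Truncation.

Context (F : fieldType).
Implicit Types p q r : {poly F}.

Definition eqmodX N p q : bool := 'X^N %| p - q.

Lemma eqmodXX N p : eqmodX N p p.
Proof. by rewrite /eqmodX subrr dvdp0. Qed.

Lemma eqmodX_sym N p q : eqmodX N p q -> eqmodX N q p.
Proof. by rewrite /eqmodX -dvdpNr opprB. Qed.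

Lemma eqmodX_trans N q p r : eqmodX N p q -> eqmodX N q r -> eqmodX N p r.
Proof. by move=> pq qr; have := dvdp_add pq qr; rewrite addrA subrK. Qed.

Lemma eqmodXB N p p' q q' :
  eqmodX N p p' -> eqmodX N q q' -> eqmodX N (p - q) (p' - q').
Proof.
move=> hp hq; rewrite /eqmodX.
have -> : p - q - (p' - q') = (p - p') - (q - q') by ring.
exact: dvdp_sub.
Qed.

Lemma eqmodXM N p p' q q' :
  eqmodX N p p' -> eqmodX N q q' -> eqmodX N (p * q) (p' * q').
Proof.
move=> hp hq; rewrite /eqmodX.
have -> : p * q - p' * q' = (p - p') * q + p' * (q - q') by ring.
by apply: dvdp_add; [apply: dvdp_mulr | apply: dvdp_mull].
Qed.

Lemma eqmodX_sum N (I : finType) (P : pred I) (f g : I -> {poly F}) :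
  (forall i, P i -> eqmodX N (f i) (g i)) ->
  eqmodX N (\sum_(i | P i) f i) (\sum_(i | P i) g i).
Proof.
move=> fg; rewrite /eqmodX -sumrB.
apply: (big_ind (fun r => 'X^N %| r)) => [|p q|i /fg//]; first exact: dvdp0.
exact: dvdp_add.
Qed.

Lemma eqmodX_prod N (I : finType) (P : pred I) (f g : I -> {poly F}) :
  (forall i, P i -> eqmodX N (f i) (g i)) ->
  eqmodX N (\prod_(i | P i) f i) (\prod_(i | P i) g i).
Proof.
move=> fg; apply: (big_ind2 (eqmodX N)) => // [|p p' q q'].
- exact: eqmodXX.
- exact: eqmodXM.
Qed.

Lemma eqmodX_leq M N p q : (N <= M)%N -> eqmodX M p q -> eqmodX N p q.
Proof. by move=> leNM; apply: dvdp_trans; rewrite dvdp_exp2l. Qed.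

Lemma eqmodXMX N k p q : eqmodX N p q -> eqmodX (k + N) ('X^k * p) ('X^k * q).
Proof. by rewrite /eqmodX -mulrBr exprD => pq; rewrite dvdp_mul. Qed.

Lemma coef_eqmodX N p q i : eqmodX N p q -> (i < N)%N -> p`_i = q`_i.
Proof.
move=> /dvdpP [r Dr] ltiN; apply/eqP; rewrite -subr_eq0 -coefB Dr.
by rewrite coefMXn ltiN.
Qed.

Lemma eqmodX_coef N p q :
  (forall i, (i < N)%N -> p`_i = q`_i) -> eqmodX N p q.
Proof.
move=> pq; rewrite /eqmodX -(poly_take_drop N (p - q)).
rewrite (_ : take_poly N (p - q) = 0) ?add0r ?dvdp_mulIr //.
by apply/polyP => i; rewrite coef_take_poly coef0 coefB; case: ifP => // /pq->; rewrite subrr.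
Qed.

(** A nonzero constant term makes [r] coprime to ['X^N]. *)
Lemma eqmodX_cancel N r p q :
  r.[0] != 0 -> eqmodX N (r * p) (r * q) -> eqmodX N p q.
Proof.
move=> r0; rewrite /eqmodX -mulrBr Gauss_dvdpr //.
by rewrite coprimep_sym coprimep_expr // coprimepX.
Qed.

Lemma eqmodX_prod_widen N m n (f : nat -> {poly F}) :
  (m <= n)%N -> (forall i, (m <= i)%N -> eqmodX N (f i) 1) ->
  eqmodX N (\prod_(i < n) f i) (\prod_(i < m) f i).
Proof.
move=> /subnKC <- f1; rewrite big_split_ord /= -[X in eqmodX _ _ X]mulr1.
apply: eqmodXM; first exact: eqmodXX.
have one : \prod_(i < n - m) 1 = 1 :> {poly F} by rewrite big1.
rewrite -[X in eqmodX _ _ X]one.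
by apply: eqmodX_prod => i _; apply: f1; rewrite leq_addr.
Qed.

Lemma eqmodX_addXn1 N k : (N <= k)%N -> eqmodX N (1 + 'X^k) 1.
Proof. by move=> leNk; rewrite /eqmodX addrAC subrr add0r dvdp_exp2l. Qed.

Lemma eqmodX_qpoch c m n : (m <= n)%N ->
  eqmodX (c * m.+1) (qpoch 'X^c n) (qpoch 'X^c m).
Proof.
move=> lemn; apply: (@eqmodX_prod_widen _ _ _ (fun i => 1 - 'X^c ^+ i.+1)) => //.
move=> i lemi; rewrite /eqmodX addrAC subrr add0r dvdpNr -exprM dvdp_exp2l //.
by rewrite leq_mul2l ltnS lemi orbT.
Qed.

Lemma horner0_qpoch c n : (0 < c)%N -> (qpoch 'X^c n : {poly F}).[0] = 1.
Proof.
move=> c0; rewrite horner_prod big1 // => i _.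
by rewrite -exprM hornerD hornerN hornerC hornerXn expr0n muln_eq0 eqn0Ngt c0 /= subr0.
Qed.

(** With [lo <= n <= hi] the two lower indices of the binomial, [qpoch n] agrees with [qpoch lo],
    and [qpoch (n + n)] with [qpoch hi], to the stated order. The product formula then leaves
    [qpoch hi] on both sides, and it cancels. *)
Lemma qbin_qpoch_eqmodX c n k : (0 < c)%N -> (k <= n + n)%N ->
  eqmodX (c * (minn k (n + n - k)).+1) (qbin 'X^c (n + n) k * qpoch 'X^c n) 1.
Proof.
move=> c0 lek; set N := (c * _)%N.
have mul := qbin_qpoch ('X^c : {poly F}) (n + n - k) k.
rewrite subnK // in mul.
pose lo := minn k (n + n - k); pose hi := maxn k (n + n - k).
have mul' : qbin 'X^c (n + n) k * qpoch 'X^c lo * qpoch 'X^c hi = qpoch 'X^c (n + n) :> {poly F}.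
  rewrite -mul /lo /hi; case: (leqP k (n + n - k)) => _ //; ring.
apply: (@eqmodX_cancel _ (qpoch 'X^c hi)); first by rewrite horner0_qpoch // oner_neq0.
rewrite mulr1.
apply: (@eqmodX_trans _ (qpoch 'X^c (n + n))).
  rewrite -mul' mulrC; apply: eqmodXM; last exact: eqmodXX.
  apply: eqmodXM; first exact: eqmodXX.
  by apply: eqmodX_qpoch; rewrite /lo; lia.
apply: (@eqmodX_leq (c * hi.+1)); first by rewrite leq_mul2l ltnS /hi; lia.
by apply: eqmodX_qpoch; rewrite /hi; lia.
Qed.

(** * The Jacobi triple product in finite form *)

(* The exponent of the theta function, at the (possibly negative) index k - n. *)
Definition theta_exp a b n k : nat :=
  if (n <= k)%N then (a * (k - n) ^ 2 + b * (k - n))%N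
  else (a * (n - k) ^ 2 - b * (n - k))%N.

Lemma prod_arith_Xn a b n :
  \prod_(i < n) ('X^(a + b) * ('X^(2 * a)) ^+ i) = 'X^(a * n ^ 2 + b * n) :> {poly F}.
Proof.
elim: n => [|n IHn]; first by rewrite big_ord0 !muln0.
rewrite big_ord_recr /= IHn -exprM -!exprD; congr ('X^_); lia.
Qed.

(* The q-binomial theorem for 2n factors, recentred at its middle term; the
   monomial 'X^s clears the negative powers that the recentring produces. *)
Lemma finite_triple_product a b n : (b <= a)%N ->
  \prod_(i < n) ((1 + 'X^(2 * a * i + (a + b))) * (1 + 'X^(2 * a * i + (a - b)))) =
  \sum_(k < (n + n).+1) qbin 'X^(2 * a) (n + n) k * 'X^(theta_exp a b n k) :> {poly F}.
Proof.
move=> leba; rewrite big_split /=; pose s := (a * n ^ 2 + b * n + 2 * a * n * n)%N.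
apply: (@mulfI _ ('X^s : {poly F})); first by rewrite expf_neq0 ?polyX_eq0.
(* Factor [i] is ['X^(2an) + 'X^(a + b + 2ai)]. The smaller exponent is pulled out of each: the
   second one for [i < n], the first one for [i >= n]. Together these monomials make ['X^s]. *)
have := qbinomial_theorem ('X^(2 * a) : {poly F}) (n + n) 'X^(2 * a * n) 'X^(a + b).
rewrite big_split_ord /=.
rewrite (eq_bigr (fun i : 'I_n => 'X^(a + b) * 'X^(2 * a) ^+ i *
   (1 + 'X^(2 * a * (n - i.+1) + (a - b))))); last first.
  move=> i _; rewrite mulrDr mulr1 addrC; congr (_ + _).
  by rewrite -exprM -!exprD; congr ('X^_); have := ltn_ord i; nia.
rewrite [X in _ * X = _ -> _](eq_bigr (fun i : 'I_n => 'X^(2 * a * n) *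
   (1 + 'X^(2 * a * i + (a + b))))); last first.
  move=> i _; rewrite mulrDr mulr1; congr (_ + _).
  by rewrite /= -exprM -!exprD; congr ('X^_); lia.
rewrite big_split /= prod_arith_Xn big_split /= prodr_const card_ord.
rewrite (reindex_inj rev_ord_inj) /=.
rewrite (eq_bigr (fun i : 'I_n => 1 + 'X^(2 * a * i + (a - b)))); last first.
  by move=> i _; rewrite -subSn ?subSS ?subKn // ltnW.
set A := \prod_(i < n) _; set B := \prod_(i < n) _ => eqn.
have -> : 'X^s * (B * A) = 'X^(a * n ^ 2 + b * n) * A * ('X^(2 * a * n) ^+ n * B).
  by rewrite /s exprD [in 'X^(_ * n)]exprM; ring.
rewrite eqn mulr_sumr; apply: eq_bigr => k _.
rewrite mulrCA -!mulrA; congr (_ * _); rewrite -!exprM -!exprD; congr ('X^_).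
rewrite /s /theta_exp; case: k => k /= ltk.
have binE : (2 * 'C(k, 2) + k = k ^ 2)%N.
  by rewrite mul2n -addnn; elim: k {ltk} => // m IHm; rewrite binS bin1; lia.
case: leqP => hk.
  (* Naming the differences removes the truncated subtractions, leaving a polynomial identity. *)
  have [j Dk] : exists j, k = (n + j)%N by exists (k - n)%N; lia.
  have [l Dn] : exists l, n = (j + l)%N by exists (n - j)%N; lia.
  have -> : (n + n - k = l)%N by lia.
  have -> : (k - n = j)%N by lia.
  by rewrite Dk Dn in binE *; nia.
have [j Dn] : exists j, n = (k + j)%N by exists (n - k)%N; lia.
have -> : (n + n - k = n + j)%N by lia.
have -> : (n - k = j)%N by lia.
have [c Da] : exists c, a = (b + c)%N by exists (a - b)%N; lia.
have -> : (a * j ^ 2 - b * j = c * j ^ 2 + (b * j ^ 2 - b * j))%N by nia.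
have : (b * j <= b * j ^ 2)%N by nia.
by rewrite Da Dn; nia.
Qed.

(** After multiplication by [qpoch], the binomial of each term is 1 up to an error of order
    [2a(min + 1)]. At distance [j] from the middle, the monomial in front raises this order to [2an]
    or more, because [a(j - 1)(j - 2) >= 0]. *)
Lemma triple_product_eqmodX a b n : (0 < a)%N -> (b <= a)%N ->
  eqmodX (2 * a * n)
    (\prod_(i < n) ((1 + 'X^(2 * a * i + (a + b))) * (1 + 'X^(2 * a * i + (a - b))))
     * qpoch 'X^(2 * a) n)
    (\sum_(k < (n + n).+1) 'X^(theta_exp a b n k)).
Proof.
move=> a0 leba; rewrite finite_triple_product // mulr_suml.
apply: eqmodX_sum => k _; have lek : (k <= n + n)%N by rewrite -ltnS.
rewrite mulrAC [_ * 'X^_]mulrC -[X in eqmodX _ _ X]mulr1.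
have := eqmodXMX (theta_exp a b n k) (@qbin_qpoch_eqmodX (2 * a) n k ltac:(lia) lek).
apply: eqmodX_leq.
rewrite /theta_exp; case: k lek => k /= _ lek; case: (leqP n k) => hk.
  have [j Dk] : exists j, k = (n + j)%N by exists (k - n)%N; lia.
  have [l Dn] : exists l, n = (j + l)%N by exists (n - j)%N; lia.
  have -> : (minn k (n + n - k) = l)%N by lia.
  have -> : (k - n = j)%N by lia.
  rewrite Dn.
  by case: j {Dk Dn} => [|[|j]]; nia.
have [j Dn] : exists j, n = (k + j)%N by exists (n - k)%N; lia.
have -> : (minn k (n + n - k) = k)%N by lia.
have -> : (n - k = j)%N by lia.
have : (b * j <= a * j)%N by nia.
(* Since [b <= a], the inequality reduces to [(j - 1)(j - 2) >= 0], true for integers only; hence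
   the cases [j = 0] and [j = 1]. *)
rewrite Dn; case: j {Dn} => [|[|j]]; nia.
Qed.

End Truncation.

(** Finite form of Euler's identity: the exponent of ['X] is [2 * 'C(k, 2) + k = k ^ 2]. *)
Lemma odd_product_qbin (F : fieldType) n :
  \prod_(i < n) (1 + 'X^((2 * i).+1)) =
  \sum_(k < n.+1) qbin 'X^2 n k * 'X^(k ^ 2) :> {poly F}.
Proof.
have := qbinomial_theorem ('X^2 : {poly F}) n 1 'X.
under eq_bigr => i _ do rewrite -exprM -exprS.
move=> ->; apply: eq_bigr => k _.
rewrite expr1n mulr1 -mulrA -exprM -exprD; congr (_ * 'X^_).
by elim: (nat_of_ord k) => // m IHm; rewrite binS bin1; lia.
Qed.

(** * Product identities over F_2 *)

Section CharacteristicTwo.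

Implicit Types p : {poly 'F_2}.

Lemma pchar_polyF2 : 2%N \in [pchar {poly 'F_2}].
Proof. by rewrite pchar_poly pchar_Fp. Qed.

Lemma sub1r_F2 p : 1 - p = 1 + p.
Proof. by rewrite (oppr_pchar2 pchar_polyF2). Qed.

Lemma sqr_1Dr_F2 p : (1 + p) ^+ 2 = 1 + p ^+ 2.
Proof. by rewrite sqrrD expr1n mul1r (mulrn_pchar pchar_polyF2) addr0. Qed.

Definition odd_product n : {poly 'F_2} := \prod_(i < n) (1 + 'X^((2 * i).+1)).

(** Signs vanish over F_2, so this is also the generating function of distinct even parts at most
    [2n]. *)
Local Notation E := (@qpoch {poly 'F_2} 'X^2).

Lemma qpochX2_S n : E n.+1 = E n * (1 + 'X^(2 * n.+1)).
Proof. by rewrite qpochS sub1r_F2 -exprM. Qed.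

Lemma odd_product_S n : odd_product n.+1 = odd_product n * (1 + 'X^((2 * n).+1)).
Proof. by rewrite /odd_product big_ord_recr. Qed.

(** The base is the product of all [1 + 'X^i] with [1 <= i <= 2n], and squaring doubles every
    exponent. *)
Lemma sqr_odd_product_E n : (odd_product n * E n) ^+ 2 = E (2 * n).
Proof.
elim: n => [|n IHn]; first by rewrite /odd_product /qpoch !big_ord0 mulr1 expr1n.
have -> : (2 * n.+1 = (2 * n).+2)%N by lia.
rewrite odd_product_S 3!qpochX2_S -IHn !exprMn !sqr_1Dr_F2 -!exprM.
rewrite [((2 * n).+1 * 2)%N]mulnC [(2 * n.+1 * 2)%N]mulnC.
have -> : (2 * (2 * n.+1) = 2 * (2 * n).+2)%N by lia.
by ring.
Qed.

(** The exponents [4i + 1] and [4i + 3] run through the odd numbers, and in characteristic 2 the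
    [qpoch] in ['X^4] is a square. *)
Lemma triple_product_2_1 n :
  \prod_(i < n) ((1 + 'X^(2 * 2 * i + (2 + 1))) * (1 + 'X^(2 * 2 * i + (2 - 1))))
    * qpoch 'X^(2 * 2) n = odd_product (2 * n) * E n ^+ 2.
Proof.
elim: n => [|n IHn]; first by rewrite /odd_product /qpoch !big_ord0 expr1n.
have -> : (2 * n.+1 = (2 * n).+2)%N by lia.
rewrite big_ord_recr /= qpochS !odd_product_S qpochX2_S [(E n * _) ^+ 2]exprMn sqr_1Dr_F2 sub1r_F2 -!exprM.
have -> : (2 * n.+1 * 2 = 2 * 2 * n.+1)%N by lia.
have -> : (2 * 2 * n + (2 + 1) = (2 * (2 * n).+1).+1)%N by lia.
have -> : (2 * 2 * n + (2 - 1) = (2 * (2 * n)).+1)%N by lia.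
set P := \prod_(i < n) _ in IHn *.
transitivity (P * qpoch 'X^(2 * 2) n * (1 + 'X^((2 * (2 * n)).+1))
  * (1 + 'X^((2 * (2 * n).+1).+1)) * (1 + 'X^(2 * 2 * n.+1))); first by ring.
by rewrite IHn; ring.
Qed.

(** The exponents [6i + 2], [6i + 4] and [6i + 6] run through the even numbers. *)
Lemma triple_product_3_1 n :
  \prod_(i < n) ((1 + 'X^(2 * 3 * i + (3 + 1))) * (1 + 'X^(2 * 3 * i + (3 - 1))))
    * qpoch 'X^(2 * 3) n = E (3 * n).
Proof.
elim: n => [|n IHn]; first by rewrite /qpoch !big_ord0 mulr1.
have -> : (3 * n.+1 = (3 * n).+3)%N by lia.
rewrite big_ord_recr /= qpochS 3!qpochX2_S sub1r_F2 -!exprM -IHn.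
have -> : (2 * 3 * n.+1 = 2 * (3 * n).+3)%N by lia.
have -> : (2 * 3 * n + (3 + 1) = 2 * (3 * n).+2)%N by lia.
have -> : (2 * 3 * n + (3 - 1) = 2 * (3 * n).+1)%N by lia.
by ring.
Qed.

(** The generating function for parameter [j], with parts bounded in terms of [M]. The ones are
    accounted for by ['X^(j ^ 2)] and the factor [1 + 'X] of [odd_product]. *)
Definition c3_term M j : {poly 'F_2} :=
  'X^(j ^ 2) * (odd_product (2 * M) * E j *
    \prod_(i < M | (j <= i)%N) (1 + 'X^(4 * i.+1))).

Lemma c3_term_eqmodX M j : (j <= M)%N ->
  eqmodX M (c3_term M j)
    (odd_product (2 * M) * E M ^+ 2 * (qbin 'X^2 M j * 'X^(j ^ 2))).
Proof.
move=> lejM; pose D : {poly 'F_2} := \prod_(i < M | (j <= i)%N) (1 - 'X^2 ^+ i.+1).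
have ED : E j * D = E M.
  rewrite /qpoch (bigID (fun i : 'I_M => (i < j)%N)) /= /D.
  rewrite (big_ord_widen _ (fun i => 1 - 'X^2 ^+ i.+1) lejM); congr (_ * _).
  by apply: eq_bigl => i; rewrite leqNgt.
have DE : D = qbin 'X^2 M j * E (M - j).
  apply: (@mulfI _ (E j)).
    apply/eqP => Ej0; have := @horner0_qpoch 'F_2 2 j isT.
    by rewrite Ej0 horner0 => /eqP; rewrite eq_sym oner_eq0.
  have := qbin_qpoch ('X^2 : {poly 'F_2}) (M - j) j.
  by rewrite subnK // ED => <-; ring.
have D2 : \prod_(i < M | (j <= i)%N) (1 + 'X^(4 * i.+1)) = D ^+ 2.
  rewrite /D -prodrXl; apply: eq_bigr => i _.
  by rewrite sub1r_F2 sqr_1Dr_F2 -!exprM; congr (1 + 'X^_); lia.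
have -> : c3_term M j = odd_product (2 * M) * E M * ('X^(j ^ 2) * D).
  by rewrite /c3_term D2 -ED; ring.
rewrite [_ * (E M) ^+ 2]mulrA -[_ * _ * E M * _]mulrA.
apply: eqmodXM; first exact: eqmodXX.
have -> : E M * (qbin 'X^2 M j * 'X^(j ^ 2)) = 'X^(j ^ 2) * (qbin 'X^2 M j * E M).
  by ring.
(* [E (M - j)] and [E M] agree to order [2(M - j + 1)], and the factor ['X^(j ^ 2)] makes up for the
   loss: the total order is [2M + (j - 1)^2 + 1]. *)
rewrite DE; apply: (@eqmodX_leq _ (j ^ 2 + 2 * (M - j).+1)); first by nia.
apply: eqmodXMX; apply: eqmodXM; first exact: eqmodXX.
by apply/eqmodX_sym/eqmodX_qpoch; rewrite leq_subr.
Qed.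

Lemma c3_gf_theta M :
  eqmodX M (\sum_(j < M.+1 | (0 < j)%N) c3_term M j)
    (\sum_(k < (M + M).+1) 'X^(theta_exp 3 1 M k)
     - \sum_(k < (M + M).+1) 'X^(theta_exp 2 1 M k)).
Proof.
have tp3 := @triple_product_eqmodX 'F_2 3 1 M isT isT.
have tp2 := @triple_product_eqmodX 'F_2 2 1 M isT isT.
rewrite triple_product_3_1 in tp3; rewrite triple_product_2_1 in tp2.
have odd2 : eqmodX M (odd_product (2 * M)) (odd_product M).
  apply: (@eqmodX_prod_widen _ _ _ _ (fun i => 1 + 'X^((2 * i).+1))); first by lia.
  by move=> i leMi; apply: eqmodX_addXn1; lia.
apply: eqmodX_trans (_ : eqmodX M _ (E (3 * M) - odd_product (2 * M) * E M ^+ 2)) _; last first.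
  apply: eqmodXB; first by apply: eqmodX_leq tp3; lia.
  by apply: eqmodX_leq tp2; lia.
apply: eqmodX_trans (_ : eqmodX M _
  (\sum_(j < M.+1 | (0 < j)%N) odd_product (2 * M) * E M ^+ 2 * (qbin 'X^2 M j * 'X^(j ^ 2)))) _.
  by apply: eqmodX_sum => j _; apply: c3_term_eqmodX; rewrite -ltnS.
rewrite -mulr_sumr.
(* The subtracted 1 is the term [j = 0] of Euler's sum. *)
have -> : \sum_(j < M.+1 | (0 < j)%N) qbin 'X^2 M j * 'X^(j ^ 2) = odd_product M - 1.
  rewrite /odd_product odd_product_qbin big_mkcond /= !big_ord_recl /= qbin0 mulr1.
  by rewrite add0r [1 + _]addrC addrK.
rewrite mulrBr mulr1; apply: eqmodXB; last exact: eqmodXX.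
(* The two lengths of [odd_product] agree modulo ['X^M], so their product is replaced by a square,
   and [sqr_odd_product_E] applies. *)
apply: eqmodX_trans (_ : eqmodX M _ (E (2 * M))) _.
  rewrite -sqr_odd_product_E exprMn mulrAC.
  apply: eqmodXM; last exact: eqmodXX.
  by rewrite expr2; apply: eqmodXM => //; apply: eqmodXX.
apply: eqmodX_sym; apply: (@eqmodX_leq _ (2 * (2 * M).+1)); first by lia.
by apply: eqmodX_qpoch; lia.
Qed.

End CharacteristicTwo.

(** * From partitions to a product over part sizes *)

Definition c3_part_ok (j k i : nat) : bool :=
  if k == 0%N then i == 0%N
  else if k == 1%N then (i == j ^ 2)%N || (i == j ^ 2 + 1)%N
  else (i <= 1)%N &&
    [|| i == 0%N, odd k, (k <= 2 * j)%N | (4 %| k)%N && (4 * j + 4 <= k)%N].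

(** Apart from the total, every condition becomes one on a single part, which is what lets the
    generating function factor. The size is a successor so that 1 is a legal index. *)
Lemma c3_condE n (m : {ffun 'I_n.+2 -> 'I_n.+2}) (j : nat) :
  is_partition m && c3_cond m j =
  [&& (0 < j)%N, \sum_(k < n.+2) k * m k == n.+1 & [forall k : 'I_n.+2, c3_part_ok j k (m k)]]%N.
Proof.
have m1E : mult m 1 = m (Ordinal (isT : 1 < n.+2)%N).
  by rewrite /mult insubT.
rewrite /is_partition /c3_cond m1E; apply/idP/idP.
  case/and3P => /andP[m0 ->] -> /and4P[m1 /forallP modd /forallP meven /forallP mbig].
  rewrite /=; apply/forallP => k; rewrite /c3_part_ok.
  case: eqP => [k0|k0]; first by rewrite (_ : k = ord0) //; apply: val_inj.
  case: eqP => [k1|k1].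
    by rewrite (_ : k = Ordinal (isT : 1 < n.+2)%N) //; apply: val_inj.
  have := modd k; have := meven k; have := mbig k.
  have -> : (0 < k)%N by lia.
  have -> : (1 < k)%N by lia.
  case: (odd k) => /=; first by move=> _ _ ->; rewrite orbT.
  move=> kbig -> _ /=; move: kbig; rewrite lt0n.
  by case: (nat_of_ord (m k) == 0%N).
case/and3P => -> -> /forallP mok; rewrite andbT /=.
have := mok ord0; rewrite /c3_part_ok /= => -> /=.
have := mok (Ordinal (isT : 1 < n.+2)%N); rewrite {1}/c3_part_ok /= => -> /=.
apply/and3P; split; apply/forallP => k; apply/implyP; have := mok k; rewrite /c3_part_ok.
- move=> + /andP[_ k1]; have -> : (k == 0 :> nat)%N = false by lia.
  have -> : (k == 1 :> nat)%N = false by lia.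
  by case/andP.
- move=> + /andP[oddk k0]; have -> : (k == 0 :> nat)%N = false by lia.
  have -> : (k == 1 :> nat)%N = false by move: oddk; case: (nat_of_ord k) => [|[]].
  by case/andP.
move=> + /and3P[oddk k0 mk0]; have -> : (k == 0 :> nat)%N = false by lia.
have -> : (k == 1 :> nat)%N = false by move: oddk; case: (nat_of_ord k) => [|[]].
by rewrite (negbTE oddk) (gtn_eqF mk0) /= => /andP[].
Qed.

(** No two positive squares differ by 1, so the number of ones determines the parameter; [c3_sum]
    can then replace the existential by a sum. *)
Lemma c3_cond_inj n (m : {ffun 'I_n.+2 -> 'I_n.+2}) (i j : nat) :
  c3_cond m i -> c3_cond m j -> i = j.
Proof.
by case/and3P => i0 mi _ /and3P[j0 mj _]; move: mi mj => /orP[]/eqP-> /orP[]/eqP; nia.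
Qed.

Lemma c3_sum n :
  c3 n.+1 = (\sum_(j < n.+3) #|[set m : {ffun 'I_n.+2 -> 'I_n.+2} |
     is_partition m && c3_cond m j]|)%N.
Proof.
rewrite /c3 -sum1_card.
under [RHS]eq_bigr => j _ do rewrite -sum1_card big_mkcond /=.
rewrite exchange_big /= big_mkcond /=; apply: eq_bigr => m _.
under [RHS]eq_bigr => j _ do rewrite inE.
rewrite inE; case: (is_partition m) => /=; last by rewrite big1.
case: existsP => [[j mj]|nomj]; last first.
  by rewrite big1 // => j _; case: ifP => // mj; case: nomj; exists j.
rewrite (bigD1 j) //= mj big1 // => i neij.
by case: ifP => // mi; case/eqP: neij; apply/val_inj/(c3_cond_inj mi mj).
Qed.

Definition c3_part_gf (R : nzRingType) n (j k : nat) : {poly R} :=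
  \sum_(i < n.+2) (if c3_part_ok j k i then 'X^(k * i) else 0).

(** Distributing the product over the sums yields one term per multiplicity function [m]: the
    monomial whose exponent is the size of [m], or 0 if some part is not admissible. *)
Lemma c3_card_coef (R : comNzRingType) n (j : nat) : (0 < j)%N ->
  #|[set m : {ffun 'I_n.+2 -> 'I_n.+2} | is_partition m && c3_cond m j]|%:R =
  (\prod_(k < n.+2) c3_part_gf R n j k)`_n.+1.
Proof.
move=> j0; rewrite /c3_part_gf.
rewrite (bigA_distr_bigA (fun (k i : 'I_n.+2) =>
  if c3_part_ok j k i then 'X^(k * i) else 0)) coef_sum -sum1_card natr_sum big_mkcond /=.
apply: eq_bigr => m _; rewrite inE c3_condE j0 /=.
case: (boolP [forall k : 'I_n.+2, c3_part_ok j k (m k)]) => [/forallP mok|].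
  rewrite (eq_bigr (fun k : 'I_n.+2 => 'X^(k * m k))); last by move=> k _; rewrite mok.
  rewrite -expr_sum coefXn andbT eq_sym.
  by case: eqP.
rewrite negb_forall andbF => /existsP[k /negbTE mk].
by rewrite (bigD1 k) //= mk mul0r coef0.
Qed.

(** * The factor contributed by each part size *)

Section PartGeneratingFunctions.

Context (F : fieldType) (n j : nat).

Definition c3_factor k : {poly F} :=
  if [|| odd k, (k <= 2 * j)%N | (4 %| k)%N && (4 * j + 4 <= k)%N]
  then 1 + 'X^k else 1.

Lemma c3_part_gf0 : c3_part_gf F n j 0 = 1.
Proof.
by rewrite /c3_part_gf big_ord_recl /= big1 ?addr0.
Qed.

(** Only a congruence: [j ^ 2] or [j ^ 2 + 1] may exceed [n.+1], the largest multiplicity summed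
    over. *)
Lemma c3_part_gf1 : eqmodX n.+2 (c3_part_gf F n j 1) ('X^(j ^ 2) * c3_factor 1).
Proof.
rewrite /c3_factor /= mulrDr mulr1 -exprSr.
apply/eqmodX_coef => i lti; rewrite coefD !coefXn coef_sum.
rewrite (bigD1 (Ordinal lti)) //= big1 ?addr0 => [|k neki]; last first.
  case: ifP; rewrite ?coef0 // coefXn mul1n.
  by case: eqP => // ik; case/eqP: neki; apply: val_inj.
rewrite /c3_part_ok /= addn1.
case: eqP => [->|nei]; rewrite ?(ltn_eqF (ltnSn _)) /=.
  by rewrite mul1n coefXn eqxx addr0.
by case: eqP => [->|]; rewrite ?mul1n ?coefXn ?eqxx ?add0r ?coef0.
Qed.

Lemma c3_part_gfSS k : c3_part_gf F n j k.+2 = c3_factor k.+2.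
Proof.
rewrite /c3_part_gf !big_ord_recl /= big1 ?addr0 => [|i _]; last first.
  by rewrite /c3_part_ok.
rewrite /c3_part_ok /bump /= muln0 muln1 /c3_factor /=.
by case: ifP; rewrite ?addr0.
Qed.

Lemma c3_prod_gf M : (n.+1 <= 4 * M)%N ->
  eqmodX n.+2 (\prod_(k < n.+2) c3_part_gf F n j k)
    ('X^(j ^ 2) * \prod_(k < 4 * M) c3_factor k.+1).
Proof.
move=> len; rewrite big_ord_recl c3_part_gf0 mul1r.
apply: (@eqmodX_trans _ _ ('X^(j ^ 2) * \prod_(k < n.+1) c3_factor k.+1)).
  rewrite !big_ord_recl mulrA; apply: eqmodXM; first exact: c3_part_gf1.
  by apply: eqmodX_prod => k _; rewrite c3_part_gfSS eqmodXX.
apply: eqmodXM; first exact: eqmodXX.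
apply: eqmodX_sym; apply: (@eqmodX_prod_widen _ _ _ _ (fun k => c3_factor k.+1)) => // k ltnk.
by rewrite /c3_factor; case: ifP => _; rewrite ?eqmodXX // eqmodX_addXn1.
Qed.

(** Induction by blocks of four consecutive parts, from [4M + 1] to [4M + 4]. *)
Lemma prod_part_factors M :
  \prod_(k < 4 * M) c3_factor k.+1 =
  \prod_(i < 2 * M) (1 + 'X^((2 * i).+1)) *
  \prod_(i < 2 * M | (i < j)%N) (1 + 'X^(2 * i.+1)) *
  \prod_(i < M | (j <= i)%N) (1 + 'X^(4 * i.+1)).
Proof.
rewrite (big_mkcond (fun i => _ < j)%N) (big_mkcond (fun i => j <= _)%N) /=.
elim: M => [|M IHM]; first by rewrite !big_ord0 !mulr1.
have -> : (4 * M.+1 = (4 * M).+4)%N by lia.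
have -> : (2 * M.+1 = (2 * M).+2)%N by lia.
rewrite !big_ord_recr /= IHM.
have -> : c3_factor (4 * M).+1 = 1 + 'X^((2 * (2 * M)).+1).
  by rewrite /c3_factor ifT; [congr (1 + 'X^_) | apply/orP; left]; lia.
have -> : c3_factor (4 * M).+3 = 1 + 'X^((2 * (2 * M).+1).+1).
  by rewrite /c3_factor ifT; [congr (1 + 'X^_) | apply/orP; left]; lia.
have -> : c3_factor (4 * M).+2 = if (2 * M < j)%N then 1 + 'X^(2 * (2 * M).+1) else 1.
  rewrite /c3_factor; have -> : ((4 * M).+2 = 2 * (2 * M).+1)%N by lia.
  by congr (if _ then _ else _); lia.
(* The two ways of allowing the part [4M + 4] exclude each other, so at most one of these factors
   differs from 1. *)
have -> : c3_factor (4 * M).+4 = (if ((2 * M).+1 < j)%N then 1 + 'X^(2 * (2 * M).+2) else 1) *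
    (if (j <= M)%N then 1 + 'X^(4 * M.+1) else 1).
  have -> : (2 * (2 * M).+2 = (4 * M).+4)%N by lia.
  have -> : (4 * M.+1 = (4 * M).+4)%N by lia.
  rewrite /c3_factor; case: (ltnP (2 * M).+1 j) => h1; case: (leqP j M) => h2; rewrite ?mulr1 ?mul1r.
  - lia.
  - by rewrite ifT //; lia.
  - by rewrite ifT //; lia.
  - by rewrite ifF //; lia.
move: (1 + _) (1 + _) (if _ then _ else _) (if _ then _ else _)
  (if _ then _ else _) (\prod_(i < _) _) (\prod_(i < _) _) (\prod_(i < _) _).
by move=> *; ring.
Qed.

End PartGeneratingFunctions.

Lemma c3_prod_gf_F2 n (j : nat) : (j <= n.+2)%N ->
  eqmodX n.+2 (\prod_(k < n.+2) c3_part_gf 'F_2 n j k) (c3_term n.+2 j).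
Proof.
move=> lej; apply: eqmodX_trans (@c3_prod_gf 'F_2 n j n.+2 ltac:(lia)) _.
rewrite prod_part_factors /c3_term; apply: eqmodXM; first exact: eqmodXX.
apply: eqmodXM; last exact: eqmodXX; apply: eqmodXM; first exact: eqmodXX.
rewrite -(big_ord_widen (2 * n.+2) (fun i => 1 + 'X^(2 * i.+1))); last by lia.
rewrite /qpoch [X in eqmodX _ _ X](eq_bigr (fun i : 'I_j => 1 + 'X^(2 * i.+1))) ?eqmodXX // => i _.
by rewrite sub1r_F2 -exprM.
Qed.

(** * Parity, and residues of the theta exponents *)

Lemma c3_even_of_theta n :
  (forall k, theta_exp 3 1 n.+2 k != n.+1) ->
  (forall k, theta_exp 2 1 n.+2 k != n.+1) ->
  c3 n.+1 = 0 %[mod 2].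
Proof.
move=> th3 th2; apply/eqP; rewrite mod0n -/(dvdn 2 _) (dvdn_pcharf (pchar_Fp (isT : prime 2))).
rewrite c3_sum natr_sum.
have -> : \sum_(j < n.+3) #|[set m : {ffun 'I_n.+2 -> 'I_n.+2} |
     is_partition m && c3_cond m j]|%:R =
   (\sum_(j < n.+3 | (0 < j)%N) \prod_(k < n.+2) c3_part_gf 'F_2 n j k)`_n.+1.
  rewrite coef_sum [RHS]big_mkcond; apply: eq_bigr => j _ /=.
  case: posnP => [j0|j0]; last by rewrite c3_card_coef.
  (* For [j = 0] nothing is counted, since [c3_cond] demands [j >= 1]. *)
  by rewrite (_ : [set m | _] = set0) ?cards0 //; apply/setP => m; rewrite !inE c3_condE j0.
rewrite (@coef_eqmodX _ n.+2 _
  (\sum_(k < (n.+2 + n.+2).+1) 'X^(theta_exp 3 1 n.+2 k)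
     - \sum_(k < (n.+2 + n.+2).+1) 'X^(theta_exp 2 1 n.+2 k))) //.
  rewrite coefB !coef_sum !big1 ?subr0 // => k _; rewrite coefXn eq_sym.
    by rewrite (negbTE (th2 k)).
  by rewrite (negbTE (th3 k)).
apply: eqmodX_trans (c3_gf_theta n.+2).
by apply: eqmodX_sum => j _; apply: c3_prod_gf_F2; rewrite -ltnS.
Qed.

(** Both branches depend only on the index modulo [d], so a finite check decides. The branch
    [a * i ^ 2 - i] is tested with [i] moved to the other side, to avoid subtraction modulo [d]. *)
Lemma theta_exp_residue a r d n k : (0 < a)%N -> (0 < d)%N ->
  all (fun i => (a * i ^ 2 + i != r %[mod d])%N && (a * i ^ 2 != r + i %[mod d])%N)
    (iota 0 d) ->
  (theta_exp a 1 n k != r %[mod d])%N.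
Proof.
move=> a0 d0 /allP nores.
have nores_mod i : (a * i ^ 2 + i != r %[mod d])%N && (a * i ^ 2 != r + i %[mod d])%N.
  have sq : (a * (i %% d) ^ 2 = a * i ^ 2 %[mod d])%N.
    by rewrite -modnMmr modnXm modnMmr.
  have := nores (i %% d)%N; rewrite mem_iota ltn_mod d0 => /(_ isT).
  by rewrite -modnDml sq modnDml !modnDmr.
rewrite /theta_exp; case: leqP => _.
  by rewrite mul1n; case/andP: (nores_mod (k - n)%N).
have /andP[_] := nores_mod (n - k)%N; apply: contra_neq => thr.
by rewrite -(modnDml r) -thr modnDml mul1n subnK //; nia.
Qed.

Theorem theorem4 (n : nat) :
  [/\ c3 (11 * n + 5) = 0 %[mod 2],
      c3 (11 * n + 7) = 0 %[mod 2] &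
      c3 (11 * n + 9) = 0 %[mod 2]].
Proof.
have main r : r \in [:: 5; 7; 9]%N -> c3 (11 * n + r) = 0 %[mod 2].
  move=> r579; have -> : (11 * n + r = (11 * n + r.-1).+1)%N.
    by move: r579; rewrite !inE => /or3P[]/eqP->; lia.
  have rS : ((11 * n + r.-1).+1 = r %[mod 11])%N.
    by move: r579; rewrite !inE => /or3P[]/eqP->; lia.
  apply: c3_even_of_theta => k.
    (* Completing the square explains the outcome of the check: [1 + 12r] is 6, 8, 10 modulo 11 for
       [r = 5, 7, 9], all nonresidues; for the form below, [1 + 8r] is 8, 2, 7, again
       nonresidues. *)
    have : (theta_exp 3 1 (11 * n + r.-1).+2 k != r %[mod 11])%N.
      by apply: theta_exp_residue => //; move: r579; rewrite !inE => /or3P[]/eqP->.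
    by apply: contra_neq => ->.
  have : (theta_exp 2 1 (11 * n + r.-1).+2 k != r %[mod 11])%N.
    by apply: theta_exp_residue => //; move: r579; rewrite !inE => /or3P[]/eqP->.
  by apply: contra_neq => ->.
by split; apply: main.
Qed.
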